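(* Let $k>0$ and $r>1$ be integers and let $c\ge 1$ be an integer with $c<2k+3$. Let $W$ be an $r\times c$ grid storage area with $n=rc$ loads labeled $1,\dots,n$ and planned departure sequence $D=(1,2,\dots,n)$. Then there exists an arrival sequence $A$ (an ordering of the $n$ loads) such that the instance $(r,c,A,D,k)$ has no zero-relocation solution. In other words, for a storage area with $r>1$ rows, at least $2k+3$ columns are necessary to guarantee a zero-relocation solution for all arrival sequences.
   Context: Storage area. $W$ is a rectangular grid of cells with $r$ rows and $c$ columns; each cell holds at most one load. The bottom row is the open side of $W$: below it lies an additional row of $c$ cells, the I/O row, each of whose cells is adjacent to the bottom-row cell directly above it (and to its horizontal neighbors in the I/O row). Two cells are adjacent if they are horizontally or vertically adjacent. Loads enter and leave only through the I/O row, and the I/O row is not used for storage. Actions. Loads are moved one at a time along paths of empty cells in the four cardinal directions, inside $W$ together with the I/O row. A storage action moves an arriving load, which appears on some cell of the I/O row, along a path of empty cells to an empty cell of $W$. A retrieval action moves a load from its cell in $W$ along a path of otherwise empty cells to some cell of the I/O row, after which the load disappears. A relocation action moves a load to another empty cell of $W$ or of the I/O row along a path of empty cells. An arrangement of the loads is an injective map from the set of loads to the cells of $W$. $k$-bounded perturbation. A permutation $\tilde S$ of a sequence $S=(s_1,\dots,s_n)$ of distinct elements is a $k$-bounded perturbation of $S$ if for every $i<j$ such that $s_j$ appears before $s_i$ in $\tilde S$ one has $j-i\le k$. Zero-relocation solution. An instance consists of $r,c$, an arrival sequence $A$, the planned departure sequence $D$, and $k$. All loads are first stored in $W$ in the order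 $A$; then they are retrieved in the order of some $k$-bounded perturbation $\tilde D$ of $D$ that is unknown during storage (and is revealed one load at a time during retrieval). A zero-relocation solution uses only one storage action and one retrieval action per load, for every possible $\tilde D$. That is, the instance has a zero-relocation solution if there is an arrangement $\mathcal A$ such that, starting from empty $W$, the loads can be stored in the order $A$ using exactly one storage action per load, ending in $\mathcal A$, and, for every $k$-bounded perturbation $\tilde D$ of $D$, starting from $\mathcal A$, the loads can be retrieved in the order $\tilde D$ using exactly one retrieval action per load. *)

(* Defs.v *)
From mathcomp Require Import all_boot.

Set Implicit Arguments.
Unset Strict Implicit.
Unset Printing Implicit Defensive.

(* The storage area W together with the I/O row: row 0 is the I/O row, rows
   1, ..., r are the rows of W, and row 1 is the bottom row of W (the open
   side). *)
Definition cell (r c : nat) : Type := ('I_r.+1 * 'I_c)%type.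

Definition in_io r c (p : cell r c) : bool := p.1 == 0 :> nat.
Definition in_W r c (p : cell r c) : bool := ~~ in_io p.

Definition succ_or_pred (i j : nat) : bool := (i == j.+1) || (j == i.+1).

Definition adjacent r c : rel (cell r c) := fun p q =>
  ((p.1 == q.1) && succ_or_pred p.2 q.2) ||
  ((p.2 == q.2) && succ_or_pred p.1 q.1).

(* The current location of each load; None if the load is not present. *)
Definition config (L : finType) (r c : nat) : Type :=
  {ffun L -> option (cell r c)}.

Section Actions.
Variables (L : finType) (r c : nat).
Implicit Types (x y : config L r c) (l : L) (p q : cell r c).

Definition no_load : config L r c := [ffun=> None].

Definition empty_cell x p : bool := [forall l, x l != Some p].

Definition update x l (o : option (cell r c)) : config L r c :=
  [ffun l' => if l' == l then o else x l'].

Definition storage_action l x y : Prop :=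
  x l = None /\
  exists p (s : seq (cell r c)),
    [/\ in_io p,
        path (@adjacent r c) p s,
        all (empty_cell x) (p :: s),
        in_W (last p s)
      & y = update x l (Some (last p s))].

Definition retrieval_action l x y : Prop :=
  exists p (s : seq (cell r c)),
    [/\ x l = Some p /\ in_W p,
        path (@adjacent r c) p s,
        all (empty_cell (update x l None)) s,
        in_io (last p s)
      & y = update x l None].

(* run act S x y: y is reached from x by exactly one action act per load of S,
   in the order of S, and no other action. *)
Fixpoint run (act : L -> config L r c -> config L r c -> Prop)
    (S : seq L) x y : Prop :=
  if S is l :: S' then exists2 z, act l x z & run act S' z y else x = y.

Definition arrangement (a : L -> cell r c) : Prop :=
  injective a /\ forall l, in_W (a l).

Definition config_of (a : L -> cell r c) : config L r c :=
  [ffun l => Some (a l)].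

End Actions.

(* Meant for a duplicate-free S, where index x S is the position of x in S. *)
Definition bounded_perturbation (T : eqType) (k : nat) (S S' : seq T) : Prop :=
  perm_eq S' S /\
  forall x y, x \in S -> y \in S ->
    index x S < index y S -> index y S' < index x S' ->
    index y S - index x S <= k.

Definition has_zero_relocation_solution (L : finType) (r c : nat)
    (A D : seq L) (k : nat) : Prop :=
  exists a : L -> cell r c,
    [/\ arrangement a,
        run (@storage_action L r c) A (no_load L r c) (config_of a)
      & forall D', bounded_perturbation k D D' ->
          run (@retrieval_action L r c) D' (config_of a) (no_load L r c)].

(* Main.v *)
Require Import Defs.
From mathcomp Require Import all_boot zify.

(** Number the loads 0, ..., n-1 and let the arrival order be 0, ..., k, then
    n-2, n-3, ..., k+1, and finally n-1, which is necessarily stored in the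
    bottom row. Let x be the least load that is not in the bottom row. If the
    loads below x-k leave first and x follows, the path of x can only reach the
    bottom row from the cell of x itself, so the cell below x holds some
    y < x-k. When x was stored, all larger loads outside the bottom row were
    already in place, so x entered through the same cell; hence y arrived after
    x, that is, y > k. Thus x >= 2k+2, and the bottom row contains 0, ..., x-1
    and n-1, which needs 2k+3 columns. *)

Set Implicit Arguments.
Unset Strict Implicit.
Unset Printing Implicit Defensive.

(** A discrete intermediate value argument. Keeping [u] and [v] on the path is what later allows the
    emptiness of its cells to be used. *)
Lemma path_crossing (T : eqType) (e : rel T) (P : pred T) p s :
  path e p s -> P p -> ~~ P (last p s) ->
  exists u v, [/\ u \in p :: s, v \in p :: s, e u v, P u & ~~ P v].
Proof.
elim: s p => [|q s IHs] p /=; first by move=> _ ->.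
move=> /andP[epq pq] Pp nPl; case: (boolP (P q)) => [Pq | nPq].
  have [u [v [us vs euv Pu Pv]]] := IHs q pq Pq nPl.
  by exists u, v; split=> //; rewrite inE ?us ?vs orbT.
by exists p, q; split=> //; rewrite !inE eqxx ?orbT.
Qed.

(** * Runs with one action per load *)

Section Runs.
Variables (L : finType) (r c : nat).
Implicit Types (x y z : config L r c) (l : L) (S : seq L).

Lemma run_cat act S1 S2 x y :
  @run L r c act (S1 ++ S2) x y ->
  exists2 z, run act S1 x z & run act S2 z y.
Proof.
elim: S1 x => [|l S1 IHS] x /=; first by exists x.
by case=> w xw /IHS[z wz zy]; exists z => //; exists w.
Qed.

(** Stated for any action that leaves all other loads in place, so that it serves both storage and
    retrieval. *)
Lemma run_notin act S x y l :
  (forall l' (u v : config L r c), act l' u v -> l != l' -> v l = u l) ->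
  @run L r c act S x y -> l \notin S -> y l = x l.
Proof.
move=> actE; elim: S x => [|l' S IHS] x /=; first by move->.
case=> z xz zy; rewrite inE negb_or => /andP[ll' lS].
by rewrite (IHS z) // (actE _ _ _ xz).
Qed.

Lemma storage_action_neq l l' x y :
  storage_action l' x y -> l != l' -> y l = x l.
Proof. by case=> _ [p [s [_ _ _ _ ->]]] /negbTE ll'; rewrite ffunE ll'. Qed.

Lemma retrieval_action_neq l l' x y :
  retrieval_action l' x y -> l != l' -> y l = x l.
Proof. by case=> p [s [_ _ _ _ ->]] /negbTE ll'; rewrite ffunE ll'. Qed.

End Runs.

(** * Full arrangements and the passage between rows 1 and 2 *)

Section Arrangement.
Variables (r c : nat) (a : 'I_(r * c) -> cell r c).
Hypothesis arr_a : arrangement a.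
Implicit Types (l x y z : 'I_(r * c)).

(** There are as many loads as cells of W, so injectivity forces surjectivity. *)
Lemma arrangement_onto p : in_W p -> exists l, a l = p.
Proof.
case: arr_a => inj_a aW pW.
pose W : {set cell r c} := [set q | in_W q].
have WE : W = setX [set~ ord0] setT.
  by apply/setP=> -[i j]; rewrite !inE andbT.
have : a @: setT == W.
  rewrite eqEcard; apply/andP; split.
    by apply/subsetP=> _ /imsetP[l _ ->]; rewrite inE.
  by rewrite card_imset // cardsT WE cardsX cardsC1 cardsT !card_ord.
move/eqP/setP/(_ p); rewrite inE pW => /imsetP[l _ ->]; by exists l.
Qed.

Definition bottom l : bool := (a l).1 == 1 :> nat.

(** Such pairs of cells are the only passages between the bottom row and the rows beyond it. *)
Definition above x y : bool :=
  [&& (a x).1 == 2 :> nat, (a y).1 == 1 :> nat & (a x).2 == (a y).2].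

Lemma above_inj x y z : above x y -> above x z -> y = z.
Proof.
case: arr_a => inj_a _ /and3P[_ y1 /eqP xy] /and3P[_ z1 /eqP xz].
apply: inj_a; apply/eqP; rewrite -pair_eqE /=.
by rewrite -xy -xz eqxx -val_eqE /= (eqP y1) (eqP z1).
Qed.

Lemma card_bottom (S : {set 'I_(r * c)}) :
  {in S, forall l, bottom l} -> #|S| <= c.
Proof.
move=> botS; rewrite -[leqRHS]card_ord.
apply: (@leq_card_in _ _ (fun l => (a l).2)) => x y xS yS xy.
case: arr_a => inj_a _; apply: inj_a; apply/eqP.
rewrite -pair_eqE /= xy eqxx -val_eqE /=.
by rewrite (eqP (botS _ xS)) (eqP (botS _ yS)).
Qed.

Lemma exists_nonbottom : 1 < r -> 0 < c -> exists l, ~~ bottom l.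
Proof.
move=> r_gt1 c_gt0; apply/existsP; rewrite -negb_forall; apply/negP => /forallP bot.
have := @card_bottom setT (fun l _ => bot l).
(* The count would give [r * c <= c]. *)
by rewrite cardsT card_ord; nia.
Qed.

Lemma nonbottomE l : ~~ bottom l = (1 < (a l).1).
Proof.
case: arr_a => _ /(_ l); rewrite /in_W /in_io /bottom.
by case: (nat_of_ord _) => [|[|]].
Qed.

(** A step that changes the row is vertical, so it joins rows 1 and 2 within one column. Both cells
    belong to W, which is full under [a], so each is the final cell of some load. *)
Lemma crossing_above (u v : cell r c) :
  adjacent u v -> u.1 <= 1 -> 1 < v.1 ->
  exists x y, [/\ a x = v, a y = u & above x y].
Proof.
move=> uv u1 v1.
have [u1E v2E uv2] : [/\ u.1 = 1 :> nat, v.1 = 2 :> nat & u.2 = v.2].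
  move: uv; rewrite /adjacent /succ_or_pred -val_eqE /=.
  case/orP=> /andP[/eqP uvE uvS]; first by lia.
  by split=> //; lia.
have [|x xv] := @arrangement_onto v; first by rewrite /in_W /in_io v2E.
have [|y yu] := @arrangement_onto u; first by rewrite /in_W /in_io u1E.
by exists x, y; split=> //; rewrite /above xv yu v2E u1E uv2 !eqxx.
Qed.

Lemma adjacentC : symmetric (@adjacent r c).
Proof.
move=> u v; rewrite /adjacent /succ_or_pred.
by rewrite (eq_sym v.1) (eq_sym v.2) (orbC (_ == _.+1)) (orbC (nat_of_ord u.1 == _)).
Qed.

(** Each load moves only once, so those of [S1] already occupy their final cells when [l] arrives.
    The path of [l] crosses from row 1 to row 2 through empty cells, whose final loads are therefore
    not in [S1]. *)
Lemma storage_crossing S1 l S2 :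
  uniq (S1 ++ l :: S2) ->
  run (@storage_action _ r c) (S1 ++ l :: S2) (no_load _ r c) (config_of a) ->
  ~~ bottom l ->
  exists x y, [/\ above x y, x \notin S1 & y \notin S1].
Proof.
rewrite cat_uniq => /and3P[_ /hasPn disj lS2].
move=> /run_cat[z _ fin] nbot.
have stored l' : l' \in S1 -> z l' = Some (a l').
  move=> l'S1; have l'S2 : l' \notin l :: S2.
    by apply/negP=> /disj /=; rewrite l'S1.
  have := run_notin (@storage_action_neq _ r c l') fin l'S2.
  by rewrite ffunE.
case: fin => z' [_ [p [s [p0 ps emp _ z'E]]]] fin.
have lastE : last p s = a l.
  have := run_notin (@storage_action_neq _ r c l) fin (andP lS2).1.
  by rewrite z'E !ffunE eqxx => -[].
have [||u [v [us vs uv u1]]] := path_crossing (P := fun q : cell r c => q.1 <= 1) ps.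
- by rewrite (eqP p0).
- by rewrite lastE -ltnNge -nonbottomE.
rewrite -ltnNge => v1; have [x [y [xv yu xy]]] := crossing_above uv u1 v1.
have free l' q : q \in p :: s -> a l' = q -> l' \notin S1.
  move=> qs l'q; apply/negP => /stored zl'.
  by have /forallP/(_ l') := allP emp _ qs; rewrite zl' l'q eqxx.
by exists x, y; split=> //; [apply: free xv | apply: free yu].
Qed.

(** The path of [l] crosses from row 2 to row 1; the loads of the two cells have left already,
    except that the upper cell may be that of [l] itself. *)
Lemma retrieval_crossing S1 l S2 w :
  l \notin S1 ->
  run (@retrieval_action _ r c) (S1 ++ l :: S2) (config_of a) w ->
  ~~ bottom l ->
  exists x y, [/\ above x y, x \in l :: S1 & y \in S1].
Proof.
move=> lS1 /run_cat[z start [z' [p [s [[zl _] ps emp s0 _]]] _]] nbot.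
have present l' : l' \notin S1 -> z l' = Some (a l').
  by move=> /(run_notin (@retrieval_action_neq _ r c l') start); rewrite ffunE.
have pE : p = a l by move: zl; rewrite present // => -[].
have [||v [u [vs us vu v1]]] := path_crossing (P := fun q : cell r c => 1 < q.1) ps.
- by rewrite pE -nonbottomE.
- by rewrite (eqP s0).
rewrite -leqNgt adjacentC in vu * => u1.
have [x [y [xv yu xy]]] := crossing_above vu u1 v1.
(* The start of the path is the cell of [l]; every later cell is free of other loads, so any other
   load placed there has been retrieved. *)
have retrieved l' q : q \in p :: s -> a l' = q -> l' \in l :: S1.
  rewrite !inE; case: (eqVneq l' l) => //= l'l /orP[/eqP-> | qs] l'q.
    by case: arr_a => inj_a _; rewrite pE in l'q; rewrite (inj_a _ _ l'q) eqxx in l'l.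
  apply: contraTT isT => /present zl'.
  by have /forallP/(_ l') := allP emp _ qs; rewrite ffunE (negbTE l'l) zl' l'q eqxx.
exists x, y; split=> //; first exact: retrieved xv.
have := retrieved _ _ us yu; rewrite inE => /orP[/eqP yl | //].
by case/and3P: xy nbot => _ + _; rewrite yl /bottom => ->.
Qed.

End Arrangement.

Lemma ltn_sorted_enum_ord n : sorted (fun i j : 'I_n => i < j) (enum 'I_n).
Proof. by have := iota_ltn_sorted 0 n; rewrite -val_enum_ord sorted_map. Qed.

Lemma mem_filter_enum (T : finType) (p : pred T) l :
  (l \in [seq y <- enum T | p y]) = p l.
Proof. by rewrite mem_filter mem_enum andbT. Qed.

(** * A perturbed departure order that advances one load *)

Section Departure.
Variables (n k : nat) (x : 'I_n).

Definition early_departure : seq 'I_n :=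
  [seq l : 'I_n <- enum 'I_n | l < x - k].

Definition late_departure : seq 'I_n :=
  [seq l : 'I_n <- enum 'I_n | (x - k <= l) && (l != x)].

Lemma mem_early l : (l \in early_departure) = (l < x - k).
Proof. exact: mem_filter_enum. Qed.

Lemma mem_late l : (l \in late_departure) = (x - k <= l) && (l != x).
Proof. by rewrite mem_filter mem_enum andbT. Qed.

(** Only [x] overtakes smaller loads, and these lie between [x - k] and [x]. *)
Lemma early_departureP :
  bounded_perturbation k (enum 'I_n) (early_departure ++ x :: late_departure).
Proof.
have ltnT : transitive (fun i j : 'I_n => i < j) by move=> ? ? ?; apply: ltn_trans.
have sorted_enum := @ltn_sorted_enum_ord n.
split.
  apply: uniq_perm; rewrite ?enum_uniq //.
    rewrite cat_uniq cons_uniq.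
    have [-> ->] : uniq early_departure /\ uniq late_departure.
      by split; apply/filter_uniq/enum_uniq.
    rewrite mem_late /= negb_or mem_early eqxx andbF -leqNgt leq_subr !andbT /=.
    by apply/hasPn=> l; rewrite mem_late /= mem_early -leqNgt => /andP[].
  move=> l; rewrite mem_cat inE mem_early mem_late mem_enum.
  by case: eqVneq => [-> | _]; rewrite ?orbT // andbT; case: ltnP.
have sorted_late := sorted_filter ltnT (fun l : 'I_n => (x - k <= l) && (l != x)) sorted_enum.
have sorted_early := sorted_filter ltnT (fun l : 'I_n => l < x - k) sorted_enum.
move=> i j _ _; rewrite !index_enum_ord => ij.
rewrite !index_cat !mem_early; case: (ltnP i (x - k)) => [ix | xi].
  case: (ltnP j (x - k)) => [jx | xj].
    move=> /(sorted_ltn_index ltnT sorted_early); rewrite !mem_early => /(_ jx ix).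
    by rewrite ltnNge ltnW.
  have : index i early_departure < size early_departure by rewrite index_mem mem_early.
  by move=> /ltnW si /(leq_ltn_trans (leq_addr _ _)); rewrite ltnNge si.
rewrite (ltnNge j) (leq_trans xi (ltnW ij)) /= ltn_add2l.
(* If [j <= x], both loads lie between [x - k] and [x], hence differ by at most [k]; if [j > x], the
   order of [i] and [j] is unchanged. *)
case: (leqP j x) => [jx | xj]; first by lia.
rewrite -!val_eqE /= (ltn_eqF xj); case: eqVneq => // xi' /=.
rewrite ltnS => /(sorted_ltn_index ltnT sorted_late).
rewrite !mem_late -!val_eqE /= (eq_sym (val j)) (ltn_eqF xj) (eq_sym (val i)) xi' xi.
by rewrite (leq_trans xi (ltnW ij)) => /(_ isT isT); rewrite ltnNge ltnW.
Qed.

End Departure.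

(** * The adversarial arrival order *)

Section Arrival.
Variables (n k : nat).

(** The guard [k < l] in the last block avoids a repeated load when [n.-1 <= k]. *)
Definition bad_arrival : seq 'I_n :=
  [seq l : 'I_n <- enum 'I_n | l <= k] ++
  rev [seq l : 'I_n <- enum 'I_n | k < l < n.-1] ++
  [seq l : 'I_n <- enum 'I_n | (k < l) && (l == n.-1 :> nat)].

Lemma perm_bad_arrival : perm_eq bad_arrival (enum 'I_n).
Proof.
apply: uniq_perm; rewrite ?enum_uniq //.
  have filter_enum_uniq p : uniq [seq l : 'I_n <- enum 'I_n | p l].
    exact/filter_uniq/enum_uniq.
  rewrite !cat_uniq rev_uniq !filter_enum_uniq !andTb ?andbT.
  apply/andP; split; apply/hasPn=> l.
    by rewrite mem_cat mem_rev !mem_filter_enum /=; lia.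
  by rewrite mem_rev !mem_filter_enum /=; lia.
move=> l; rewrite !mem_cat mem_rev !mem_filter_enum mem_enum.
by rewrite inE; have := ltn_ord l; lia.
Qed.

(** The loads outside [S1] are [l] and the later arrivals: from [l] on, the order descends until
    [n.-1] closes it. *)
Lemma bad_arrival_split (l : 'I_n) :
  k < l -> exists S1 S2, bad_arrival = S1 ++ l :: S2 /\
    forall y, y \notin S1 -> k < y /\ (y <= l < n.-1) || (y == n.-1 :> nat).
Proof.
move=> kl; have gtnT : transitive (fun i j : 'I_n => j < i).
  by move=> i j h ji hi; apply: ltn_trans hi ji.
pose mid := rev [seq y : 'I_n <- enum 'I_n | k < y < n.-1].
have memM (y : 'I_n) : (y \in mid) = (k < y < n.-1).
  by rewrite mem_rev mem_filter_enum.
have sorted_mid : sorted (fun i j : 'I_n => j < i) mid.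
  rewrite rev_sorted sorted_filter //.
    by move=> i j h ij jh; apply: ltn_trans ij jh.
  exact: ltn_sorted_enum_ord.
case: (ltnP l n.-1) => [ln | nl]; last first.
  have lE : (l : nat) = n.-1 by have := ltn_ord l; lia.
  exists ([seq y : 'I_n <- enum 'I_n | y <= k] ++ mid), [::]; split.
    rewrite /bad_arrival catA; congr (_ ++ _).
    rewrite -(filter_pred1_uniq (enum_uniq 'I_n) (mem_enum _ l)).
    by apply: eq_filter => y /=; rewrite -val_eqE /=; lia.
  move=> y; rewrite mem_cat memM mem_filter_enum.
  by have := ltn_ord y; lia.
have := memM l; rewrite kl ln /= => lM.
case/splitPr: {-2}mid / lM (erefl mid) => M1 M2 /esym midE.
exists ([seq y : 'I_n <- enum 'I_n | y <= k] ++ M1).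
exists (M2 ++ [seq y : 'I_n <- enum 'I_n | (k < y) && (y == n.-1 :> nat)]); split.
  by rewrite /bad_arrival -/mid midE -!catA.
move=> y; rewrite mem_cat mem_filter_enum negb_or => /andP[ky yM1].
have {}ky : k < y by rewrite ltnNge.
split=> //; case: (ltnP y n.-1) => [yn | ny]; last by have := ltn_ord y; lia.
have := memM y; rewrite ky yn midE mem_cat (negbTE yM1) inE /=.
case: eqVneq => [-> | _ /= yM2]; first by rewrite leqnn.
move: sorted_mid; rewrite (sorted_pairwise gtnT) midE pairwise_cat /=.
case/and3P=> _ _ /andP[/allP/(_ y yM2) yl _].
by rewrite ltnW.
Qed.

End Arrival.

Theorem theorem3 (r c k : nat) (hk : 0 < k) (hr : 1 < r) (hc1 : 1 <= c)
    (hc : c < 2 * k + 3) :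
  exists A : seq 'I_(r * c),
    perm_eq A (enum 'I_(r * c)) /\
    ~ has_zero_relocation_solution r c A (enum 'I_(r * c)) k.
Proof.
exists (bad_arrival (r * c) k); split; first exact: perm_bad_arrival.
case=> a [arr_a stored retrieved].
have [x0 nbot0] := exists_nonbottom arr_a hr hc1.
case: (@arg_minnP _ x0 (fun l => ~~ bottom a l) val nbot0) => x nbotx min_x {x0 nbot0}.
have above_nbot u v : above a u v -> ~~ bottom a u.
  by case/and3P=> /eqP u2 _ _; rewrite /bottom u2.
have above_bot u v : above a u v -> bottom a v by case/and3P.
(* The upper load of the crossing is [x] itself, since an early one would be a smaller load outside
   the bottom row. *)
have [y [xy yx]] : exists y, above a x y /\ y < x - k.
  have xE : x \notin early_departure k x by rewrite mem_early ltnNge leq_subr.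
  have [u [y [uy]]] :=
    retrieval_crossing arr_a xE (retrieved _ (early_departureP k x)) nbotx.
  rewrite inE !mem_early => u_early yx.
  exists y; split=> //; case/orP: u_early => [/eqP<- // | ux].
  by have /= := min_x _ (above_nbot _ _ uy); lia.
have uniqA : uniq (bad_arrival (r * c) k).
  by rewrite (perm_uniq (perm_bad_arrival _ _)) enum_uniq.
have n_gt0 : 0 < r * c by rewrite muln_gt0 (ltnW hr).
pose m := Ordinal (eq_ind_r (fun n => n <= r * c) (leqnn _) (prednK n_gt0)).
(* All other loads precede [m], so a crossing would force [u = v = m], a load above itself. *)
have botm : bottom a m.
  apply: contraT => nbotm.
  have km : k < m by rewrite /=; have := ltn_ord x; lia.
  have [S1 [S2 [AE late]]] := bad_arrival_split km.
  have := storage_crossing arr_a (l := m) (S1 := S1) (S2 := S2).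
  rewrite -AE => /(_ uniqA stored nbotm)[u [v [uv /late[_ um] /late[_ vm]]]].
  have uE : u = v by apply: val_inj; move: um vm => /=; lia.
  by have := above_nbot _ _ uv; rewrite uE (above_bot _ _ uv).
have xm : x != m by apply: contraNneq nbotx => ->.
have ky : k < y.
  have kx : k < x by lia.
  have [S1 [S2 [AE late]]] := bad_arrival_split kx.
  have := storage_crossing arr_a (l := x) (S1 := S1) (S2 := S2).
  rewrite -AE => /(_ uniqA stored nbotx)[u [v [uv /late[_ ux] /late[kv _]]]].
  (* Loads not yet stored are at most [x] or equal to [m]; [u] is outside the bottom row, so it is
     not [m], and minimality gives [x <= u]. *)
  have uE : u = x.
    apply: val_inj; have /= := min_x _ (above_nbot _ _ uv).
    have : u != m by apply: contraNneq (above_nbot _ _ uv) => ->.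
    by move: ux; rewrite -val_eqE /=; lia.
  by rewrite uE in uv; rewrite (above_inj arr_a xy uv).
(* By minimality of [x] these loads are all in the bottom row; with [m] they need [x + 1] columns,
   while [k < y < x - k] gives [2 * k + 2 <= x]. *)
pose low := [set widen_ord (ltnW (ltn_ord x)) i | i : 'I_x].
have card_low : #|low| = x.
  rewrite card_imset ?card_ord // => i j /(congr1 val) /= ij; exact: val_inj.
have lowP l : l \in low -> l < x by case/imsetP=> i _ ->; exact: (ltn_ord i).
have := @card_bottom _ _ _ arr_a (m |: low).
rewrite cardsU1 card_low; have -> /= : m \notin low.
  by apply/negP=> /lowP /=; move: xm (ltn_ord x); rewrite -val_eqE /=; lia.
have botS : {in m |: low, forall l, bottom a l}.
  move=> l /setU1P[-> // | /lowP lx]; apply: contraT => /min_x /=; lia.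
by move=> /(_ botS); lia.
Qed.
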